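(* Let $C_{(\neq,>)}(x,y)$ be the bivariate generating function of the Catalan words avoiding the ordered pair of relations $(\neq,>)$, where $x$ marks the length and $y$ marks the number of descents. Then $$C_{(\neq,>)}(x,y)=\frac{1 - 2 x + 2 x^2 y - \sqrt{1 - 4 x + 4 x^2 - 4 x^3 y}}{2 x^2 y}.$$
   Context: A Catalan word of length $n$ is a word $w=w_1w_2\cdots w_n$ over the non-negative integers with $w_1=0$ and $0\leq w_i\leq w_{i-1}+1$ for $i=2,\dots,n$; the empty word is the unique Catalan word of length $0$. For relations $X,Y\in\{<,>,\leq,\geq,=,\neq\}$, a word $w$ contains the pattern $(X,Y)$ if there is an index $i\geq 1$ (with $i+2\le n$) such that $w_i\,X\,w_{i+1}$ and $w_{i+1}\,Y\,w_{i+2}$; otherwise $w$ avoids $(X,Y)$. The number of descents $\mathrm{des}(w)$ is the number of indices $i$ with $w_i>w_{i+1}$. The bivariate generating function is $C_{(X,Y)}(x,y)=\sum_{w}x^{|w|}y^{\mathrm{des}(w)}$, the sum being over all Catalan words $w$ (of any length $|w|\geq 0$) avoiding $(X,Y)$. Identities are between formal power series in $x$ with coefficients polynomials in $y$ (after clearing denominators); the square root of a power series with constant term $1$ is the one with constant term $1$. *)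

(* Defs.v *)
From HB Require Import structures.
From mathcomp Require Import all_boot all_order all_algebra.
From mathcomp Require Import boolp classical_sets.

Set Implicit Arguments.
Unset Strict Implicit.
Unset Printing Implicit Defensive.

Import GRing.Theory.

Local Open Scope ring_scope.

Record fps (R : Type) : Type := Fps { fps_coef : nat -> R }.

Lemma fpsP (R : Type) (f g : fps R) :
  (forall n, fps_coef f n = fps_coef g n) -> f = g.
Proof. by case: f g => [f] [g] /= fg; congr Fps; apply/funext. Qed.

HB.instance Definition _ (R : Type) := gen_eqMixin (fps R).
HB.instance Definition _ (R : Type) := gen_choiceMixin (fps R).

Section FpsRing.
Variable R : comNzRingType.
Implicit Types f g h : fps R.

Definition fps_zero : fps R := Fps (fun=> 0).
Definition fps_opp f : fps R := Fps (fun n => - fps_coef f n).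
Definition fps_add f g : fps R := Fps (fun n => fps_coef f n + fps_coef g n).
Definition fps_one : fps R := Fps (fun n => (n == 0%N)%:R).
Definition fps_mul f g : fps R :=
  Fps (fun n => \sum_(i < n.+1) fps_coef f i * fps_coef g (n - i)%N).

Fact fps_addA : associative fps_add.
Proof. by move=> f g h; apply: fpsP => n /=; rewrite addrA. Qed.
Fact fps_addC : commutative fps_add.
Proof. by move=> f g; apply: fpsP => n /=; rewrite addrC. Qed.
Fact fps_add0 : left_id fps_zero fps_add.
Proof. by move=> f; apply: fpsP => n /=; rewrite add0r. Qed.
Fact fps_addN : left_inverse fps_zero fps_opp fps_add.
Proof. by move=> f; apply: fpsP => n /=; rewrite addNr. Qed.

HB.instance Definition _ :=
  GRing.isZmodule.Build (fps R) fps_addA fps_addC fps_add0 fps_addN.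

Definition fps_trunc (N : nat) f : {poly R} := \poly_(i < N) fps_coef f i.

Lemma coef_fps_mul_trunc N f g n : (n < N)%N ->
  fps_coef (fps_mul f g) n = (fps_trunc N f * fps_trunc N g)`_n.
Proof.
move=> nN; rewrite coefM /=; apply: eq_bigr => i _.
have iN : (i < N)%N by apply: leq_trans nN; apply: ltn_ord.
by rewrite !coef_poly iN (leq_ltn_trans (leq_subr _ _) nN).
Qed.

Fact fps_mulC : commutative fps_mul.
Proof.
by move=> f g; apply: fpsP => n; rewrite !(@coef_fps_mul_trunc n.+1) // mulrC.
Qed.

Fact fps_mulA : associative fps_mul.
Proof.
move=> f g h; apply: fpsP => n.
set F := fps_trunc n.+1 f; set G := fps_trunc n.+1 g.
set H := fps_trunc n.+1 h.
transitivity (F * G * H)`_n.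
  rewrite -mulrA coefM /=; apply: eq_bigr => i _.
  have ni : (n - i < n.+1)%N by rewrite ltnS leq_subr.
  by rewrite -(coef_fps_mul_trunc _ _ ni) coef_poly ltn_ord.
rewrite coefM /=; apply: eq_bigr => i _.
have ni : (n - i < n.+1)%N by rewrite ltnS leq_subr.
by rewrite -(coef_fps_mul_trunc _ _ (ltn_ord i)) coef_poly ni.
Qed.

Fact fps_mul1 : left_id fps_one fps_mul.
Proof.
move=> f; apply: fpsP => n /=.
rewrite big_ord_recl /= mul1r subn0 big1 ?addr0 // => i _.
by rewrite mul0r.
Qed.

Fact fps_mulDl : left_distributive fps_mul fps_add.
Proof.
move=> f g h; apply: fpsP => n /=.
by rewrite -big_split; apply: eq_bigr => i _; rewrite mulrDl.
Qed.

Fact fps_one_neq0 : fps_one != fps_zero.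
Proof.
apply/eqP => /(congr1 (fun f => fps_coef f 0)) /= /eqP.
by rewrite oner_eq0.
Qed.

HB.instance Definition _ := GRing.Zmodule_isComNzRing.Build (fps R)
  fps_mulA fps_mulC fps_mul1 fps_mulDl fps_one_neq0.

Lemma coef_fpsM f g n :
  fps_coef (f * g) n = \sum_(i < n.+1) fps_coef f i * fps_coef g (n - i)%N.
Proof. by []. Qed.

Definition fpsC (c : R) : fps R := Fps (fun n => c *+ (n == 0%N)).
Definition fpsX : fps R := Fps (fun n => (n == 1%N)%:R).

(* The square root with constant term 1; 0 when there is no such root. *)
Definition fps_sqrt f : fps R :=
  xget 0 [set s : fps R | fps_coef s 0 = 1 /\ s ^+ 2 = f]%classic.

End FpsRing.

Lemma fps_sqrtE (R : idomainType) (f s : fps R) : (2 : R) != 0 ->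
  fps_coef s 0 = 1 -> s ^+ 2 = f -> fps_sqrt f = s.
Proof.
move=> two0 s0 sf; apply: xget_unique => [|t [t0 tf]]; first by split.
have st0 : (t - s) * (t + s) = 0 by rewrite -subr_sqr sf tf subrr.
apply/eqP; rewrite -subr_eq0; apply/eqP.
move: (t - s) st0 => d st0; apply: fpsP; elim/ltn_ind => n IHn.
have := congr1 (fun f => fps_coef f n) st0.
rewrite coef_fpsM big_ord_recr /= subnn big1 => [|i _]; last by rewrite IHn ?mul0r.
rewrite add0r s0 t0 => /eqP; rewrite mulf_eq0 (negbTE two0) orbF.
by move/eqP.
Qed.

Definition is_catalan (w : seq nat) : bool :=
  (head 0%N w == 0%N) && sorted (fun a b => b <= a.+1)%N w.

Definition contains (X Y : rel nat) (w : seq nat) : bool :=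
  [exists i : 'I_(size w),
     [&& (i.+2 < size w)%N, X (nth 0%N w i) (nth 0%N w i.+1)
       & Y (nth 0%N w i.+1) (nth 0%N w i.+2)]].

Definition avoids (X Y : rel nat) (w : seq nat) : bool := ~~ contains X Y w.

Definition des (w : seq nat) : nat :=
  \sum_(i < (size w).-1) (nth 0 w i.+1 < nth 0 w i)%N.

(* Justifies enumerating the Catalan words of length n as n-tuples over 'I_n. *)
Lemma catalan_letter_bound (w : seq nat) :
  is_catalan w -> all (fun a => a < size w)%N w.
Proof.
case: w => [//|a w] /andP[/= /eqP-> pw]; apply/andP; split=> //.
have: forall m N, (m + size w < N)%N ->
    path (fun a b => b <= a.+1)%N m w -> all (fun a => a < N)%N w.
  elim: w {pw} => [//|b w IHw] m N /= mN /andP[bm bw].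
  have bN : (b + size w < N)%N.
    by apply: leq_ltn_trans mN; rewrite addnS -addSn leq_add2r.
  by rewrite (IHw b) // andbT (leq_ltn_trans (leq_addr _ _) bN).
by apply; last exact: pw.
Qed.

(* Power series in x over {poly rat}, the polynomial variable 'X being y. *)
Definition catalan_gf (X Y : rel nat) : fps {poly rat} :=
  Fps (fun n =>
    \sum_(w : n.-tuple 'I_n |
          is_catalan (map val w) && avoids X Y (map val w))
      'X^(des (map val w))).

(* Main.v *)
(* Read a word letter by letter, remembering the last letter a and whether it
   differs from its predecessor. Let A_a (no) and B_a (yes) be the generating
   functions of the possible continuations, so that A_0 = B_0 = A and
   C = 1 + x A. Then B_a = 1 + x (A_a + B_{a+1}) and
   A_a = B_a + x y (B_0 + ... + B_{a-1}), because a descent may only follow an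
   equality. The solution is geometric, B_a = A (1 + x^2 y A)^a, so the
   equation for a = 0 becomes the quadratic A = 1 + 2 x A + x^3 y A^2. *)
Require Import Defs.
From mathcomp Require Import all_boot all_order all_algebra.
From mathcomp Require Import ring.

Set Implicit Arguments.
Unset Strict Implicit.
Unset Printing Implicit Defensive.

Import GRing.Theory.

Local Open Scope ring_scope.

Section FpsCoef.
Variable R : comNzRingType.
Implicit Types f g : fps R.

Lemma coef_fpsD f g n : fps_coef (f + g) n = fps_coef f n + fps_coef g n.
Proof. by []. Qed.

Lemma coef_fpsN f n : fps_coef (- f) n = - fps_coef f n.
Proof. by []. Qed.

Lemma coef_fps1 n : fps_coef (1 : fps R) n = (n == 0%N)%:R.
Proof. by []. Qed.

Lemma coef_fps_sum (I : Type) (r : seq I) (P : pred I) (F : I -> fps R) n :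
  fps_coef (\sum_(i <- r | P i) F i) n = \sum_(i <- r | P i) fps_coef (F i) n.
Proof. by elim/big_rec2: _ => [//|i u v _ <-]. Qed.

Lemma coef_fpsXM f n :
  fps_coef (fpsX R * f) n = if n is m.+1 then fps_coef f m else 0.
Proof.
case: n => [|n]; rewrite coef_fpsM big_ord_recl /= mul0r add0r ?big_ord0 //.
rewrite big_ord_recl /= mul1r subn1 /= big1 ?addr0 // => i _.
by rewrite mul0r.
Qed.

Lemma coef_fpsCM c f n : fps_coef (fpsC c * f) n = c * fps_coef f n.
Proof.
rewrite coef_fpsM big_ord_recl /= subn0 big1 ?addr0 // => i _.
by rewrite mul0r.
Qed.

End FpsCoef.

Definition coef_fpsE := (coef_fpsD, coef_fpsN, coef_fps1,
  coef_fpsXM, coef_fpsCM, coef_fps_sum).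

(* [w] may follow the letter [a] in an avoiding Catalan word, [f] recording
   whether [a] differs from the letter before it. *)
Fixpoint suffix_ok (a : nat) (f : bool) (w : seq nat) : bool :=
  if w is b :: w' then
    [&& (b <= a.+1)%N, ~~ (f && (b < a)%N) & suffix_ok b (a != b) w']
  else true.

Lemma exists_ordS n (P : pred nat) :
  [exists i : 'I_n.+1, P i] = P 0%N || [exists i : 'I_n, P i.+1].
Proof.
apply/existsP/orP => [[[[|i] lti] Pi]|[P0|/existsP[i Pi]]].
- by left.
- by right; apply/existsP; exists (Ordinal (lti : (i < n)%N)).
- by exists ord0.
- by exists (lift ord0 i).
Qed.

Lemma contains_cons X Y a b c w :
  contains X Y [:: a, b, c & w] = X a b && Y b c || contains X Y [:: b, c & w].
Proof.
by rewrite {1}/contains (exists_ordS _ (fun i : nat =>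
  [&& (i.+2 < _)%N, X (nth 0%N _ i) (nth 0%N _ i.+1)
    & Y (nth 0%N _ i.+1) (nth 0%N _ i.+2)])).
Qed.

Lemma contains_short X Y w : (size w <= 2)%N -> contains X Y w = false.
Proof.
move=> w2; apply/existsP => -[i /and3P[iw _ _]].
by have := leq_trans iw w2.
Qed.

Lemma des_cons a b w : des [:: a, b & w] = ((b < a)%N + des (b :: w))%N.
Proof. by rewrite /des /= big_ord_recl. Qed.

(** The flag passed on after [b] is [a != b], so the descent test at the next letter is exactly the
    occurrence that [contains_cons] splits off. *)
Lemma suffix_ok_path a b w :
  suffix_ok a false (b :: w) =
  path (fun c d => d <= c.+1)%N a (b :: w) &&
  avoids (fun c d => c != d) (fun c d => c > d)%N [:: a, b & w].
Proof.
rewrite /avoids; elim: w a b => [|c w IHw] a b.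
  by rewrite contains_short //= !andbT.
move: (IHw b c); rewrite contains_cons negb_or /= => IH.
case: (b <= a.+1)%N => //=.
move: IH; case: (c <= b.+1)%N => //= IH.
by rewrite andbCA -IH.
Qed.

Lemma catalan_avoids_cons a w :
  is_catalan (a :: w) &&
    avoids (fun c d => c != d) (fun c d => c > d)%N (a :: w) =
  (a == 0%N) && suffix_ok 0 false w.
Proof.
rewrite /is_catalan /= -andbA; have [->|//] := eqVneq a 0%N; rewrite /=.
case: w => [|b w]; last by rewrite suffix_ok_path.
by rewrite /avoids contains_short.
Qed.

Lemma big_tuple_cons (V : nmodType) (T : finType) n
    (P : pred (seq T)) (F : seq T -> V) :
  \sum_(w : n.+1.-tuple T | P w) F w =
  \sum_(b : T) \sum_(w : n.-tuple T | P (b :: w)) F (b :: w).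
Proof.
rewrite pair_big_dep /=.
rewrite (reindex (fun p : T * n.-tuple T => [tuple of p.1 :: p.2])) //=.
exists (fun w : n.+1.-tuple T => (thead w, [tuple of behead w])).
  by case=> b w _; congr (_, _); apply: val_inj.
by move=> w _; rewrite [w in RHS]tuple_eta; apply: val_inj.
Qed.

(** Descent polynomial of the continuations of length [n], the step from [a] to their first letter
    included. *)
Fixpoint suffix_weight (n a : nat) (f : bool) : {poly rat} :=
  if n is m.+1 then
    \sum_(b < a.+2 | ~~ (f && (b < a)%N))
      'X^(b < a)%N * suffix_weight m b (a != b)
  else 1.

(** Letters rise by at most one per step, so the bound keeps every continuation inside the alphabet
    ['I_N], which stays fixed during the induction. *)
Lemma suffix_weightE N n a f : (a + n < N)%N ->
  \sum_(w : n.-tuple 'I_N | suffix_ok a f (map val w)) 'X^(des (a :: map val w))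
  = suffix_weight n a f.
Proof.
elim: n a f => [|n IHn] a f aN.
  rewrite (big_pred1 [tuple]) => [|w]; first by rewrite /= /des big_ord0.
  by rewrite tuple0 /= eqxx.
rewrite (big_tuple_cons _ (fun w => suffix_ok a f (map val w))
           (fun w => 'X^(des (a :: map val w)))) /=.
have aN2 : (a.+2 <= N)%N.
  by apply: leq_trans aN; rewrite addnS ltnS ltnS leq_addr.
rewrite (big_ord_widen_cond _ (fun b => ~~ (f && (b < a)%N))
  (fun b => 'X^(b < a)%N * suffix_weight n b (a != b)) aN2).
rewrite [RHS]big_mkcond /=; apply: eq_bigr => b _.
rewrite ltnS; case: (leqP b a.+1) => /= ba; last by rewrite andbF big_pred0.
rewrite andbT.
case: ifP => _ /=; last by rewrite big_pred0.
rewrite -(IHn b) ?mulr_sumr; last first.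
  by rewrite (leq_ltn_trans _ aN) // addnS -addSn leq_add2r.
by apply: eq_bigr => w _; rewrite des_cons exprD.
Qed.

(** [suffix_gf false a] is A_a and [suffix_gf true a] is B_a. *)
Definition suffix_gf (f : bool) (a : nat) : fps {poly rat} :=
  Fps (fun n => suffix_weight n a f).

Local Notation x := (fpsX {poly rat}).
Local Notation y := (fpsC ('X : {poly rat})).

Lemma catalan_gf_suffix :
  catalan_gf (fun a b : nat => a != b) (fun a b : nat => (a > b)%N) =
  1 + x * suffix_gf false 0.
Proof.
apply: fpsP => -[|n]; rewrite !coef_fpsE /=.
  rewrite (big_pred1 [tuple]) => [|w]; first by rewrite /= /des big_ord0 addr0.
  by rewrite tuple0 /avoids contains_short.
rewrite add0r -(@suffix_weightE n.+1) //.
rewrite (big_tuple_cons _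
  (fun w => is_catalan (map val w) && avoids _ _ (map val w))
  (fun w => 'X^(des (map val w)))) /= (bigD1 ord0) //= [X in _ + X]big1.
  by rewrite addr0; apply: eq_bigl => w; rewrite catalan_avoids_cons.
move=> b b0; rewrite big_pred0 // => w; rewrite catalan_avoids_cons.
by rewrite -(inj_eq val_inj) /= in b0; rewrite (negbTE b0).
Qed.

(** After a change no descent may follow, which leaves the letters [a] and [a.+1]; only the second
    sets the flag again. *)
Lemma suffix_weight_neq n a :
  suffix_weight n.+1 a true =
  suffix_weight n a false + suffix_weight n a.+1 true.
Proof.
rewrite /= big_mkcond /= !big_ord_recr /= big1 => [|b _].
  by rewrite !ltnn ltnNge leqnSn /= eqxx neq_ltn ltnSn add0r !mul1r.
by rewrite ltn_ord.
Qed.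

(** After an equality the letters below [a] become available too; each makes a descent, hence the
    factor ['X], and sets the flag. *)
Lemma suffix_weight_eq n a :
  suffix_weight n.+1 a false =
  suffix_weight n.+1 a true + 'X * \sum_(b < a) suffix_weight n b true.
Proof.
rewrite suffix_weight_neq /= !big_ord_recr /=.
rewrite !ltnn ltnNge leqnSn /= eqxx neq_ltn ltnSn /= !mul1r -addrA addrC.
congr (_ + _); rewrite mulr_sumr; apply: eq_bigr => b _.
by rewrite /= ltn_ord expr1 neq_ltn ltn_ord orbT.
Qed.

Lemma suffix_gf_neq a :
  suffix_gf true a = 1 + x * (suffix_gf false a + suffix_gf true a.+1).
Proof.
apply: fpsP => -[|n]; rewrite !coef_fpsE; first by rewrite addr0.
by rewrite add0r [LHS]suffix_weight_neq.
Qed.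

Lemma suffix_gf_eq a :
  suffix_gf false a =
  suffix_gf true a + x * (y * \sum_(b < a) suffix_gf true b).
Proof.
apply: fpsP => -[|n]; rewrite !coef_fpsE; first by rewrite addr0.
by rewrite [LHS]suffix_weight_eq.
Qed.

(* The difference D of the two sides vanishes because the functional equations
   express D_b as x times a combination of the D_c. *)
Lemma suffix_gf_geometric a :
  suffix_gf true a =
  suffix_gf true 0 * (1 + x ^+ 2 * y * suffix_gf true 0) ^+ a.
Proof.
set A := suffix_gf true 0; set T := 1 + _.
pose D b := suffix_gf true b - A * T ^+ b.
(* Geometric sum, using T - 1 = x^2 y A. *)
have sumT b : x * (x * (y * \sum_(c < b) A * T ^+ c)) = T ^+ b - 1.
  by rewrite subrX1 -mulr_sumr /T; ring.
(* The subtracted term is what the right side of the recurrence becomes when every B_c is replaced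
   by A T^c. *)
have BE b : suffix_gf true b - T ^+ b * (1 + x * A + x * A * T)
    = x * (D b + x * (y * \sum_(c < b) D c) + D b.+1).
  rewrite {1}suffix_gf_neq suffix_gf_eq /D big_split /= sumrN exprSr.
  rewrite -(canLR (subrK _) (sumT b)).
  by ring.
(* Since D_0 = 0, the case b = 0 gives A - (1 + x A + x A T) = x D_1, which trades the bracket for
   A. *)
have DE b : D b =
    x * (D b + x * (y * \sum_(c < b) D c) + D b.+1 - T ^+ b * D 1%N).
  have := BE 0%N; rewrite big_ord0 expr0 {1}/D expr0 mulr1 subrr.
  rewrite !mulr0 !add0r mul1r => D1E.
  by rewrite [RHS]mulrBr -BE mulrCA -D1E /D -/A; ring.
(* The induction is on the degree, for all [b] at once, since D_b calls on D_(b+1); the factor x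
   lowers the degree. *)
have D0 n b : fps_coef (D b) n = 0.
  clearbody D; elim/ltn_ind: n b => -[|n] IHn b; rewrite DE coef_fpsXM //.
  rewrite !coef_fpsE !IHn // coef_fpsM [X in _ - X]big1 => [|i _]; last first.
    by rewrite IHn ?mulr0 // ltnS leq_subr.
  rewrite subr0 addr0 add0r; case: n IHn => // n IHn.
  rewrite coef_fpsCM coef_fps_sum big1 ?mulr0 // => c _.
  by rewrite IHn.
by apply/eqP; rewrite -subr_eq0; apply/eqP/fpsP => n; apply: D0.
Qed.

Theorem theorem3p39 :
  let x : fps {poly rat} := fpsX {poly rat} in
  let y : fps {poly rat} := fpsC ('X : {poly rat}) in
  let C : fps {poly rat} :=
    catalan_gf (fun a b : nat => a != b) (fun a b : nat => (a > b)%N) in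
  2 * x ^+ 2 * y * C
  = 1 - 2 * x + 2 * x ^+ 2 * y
    - fps_sqrt (1 - 4 * x + 4 * x ^+ 2 - 4 * x ^+ 3 * y).
Proof.
move=> x y C.
have CE : C = 1 + x * suffix_gf true 0.
  by rewrite /C catalan_gf_suffix suffix_gf_eq big_ord0 !mulr0 addr0.
have := suffix_gf_neq 0; rewrite suffix_gf_eq big_ord0 !mulr0 addr0.
rewrite (suffix_gf_geometric 1) expr1; move: (suffix_gf true 0) CE => A CE AE.
(* The root is read off by solving the claimed identity for it. *)
rewrite (@fps_sqrtE _ _ (1 - 2 * x + 2 * x ^+ 2 * y - 2 * x ^+ 2 * y * C)).
- by ring.
- by rewrite -polyC_natr polyC_eq0.
- have -> : 1 - 2 * x + 2 * x ^+ 2 * y - 2 * x ^+ 2 * y * C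
      = 1 + x * (2 * x * y - 2 - 2 * x * y * C) by ring.
  by rewrite !coef_fpsE addr0.
(* With C = 1 + x A the candidate is 1 - 2 x - 2 x^3 y A, and its square minus the radicand is 4 x^3
   y times the quadratic equation [AE] for A. *)
- apply/subr0_eq; transitivity (4 * x ^+ 3 * y *
      (1 + x * (A + A * (1 + x ^+ 2 * y * A)) - A)); first by rewrite CE; ring.
  by rewrite -AE subrr mulr0.
Qed.
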